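(* Let $A=(a_{ij})$ be an $n_1\times m_1$ matrix with entries $\pm1$, $B=(b_{ij})$ an $n_2\times m_2$ design, $C=(c_{ij})$ an $n_1\times m_1$ design, $D=(d_{ij})$ an $n_2\times m_2$ matrix with entries $\pm1$, and let $\gamma=n_2$. Put $$L=A\otimes B+\gamma\, C\otimes D .$$ Then $L$ is an orthogonal Latin hypercube (with $n_1n_2$ runs and $m_1m_2$ factors) if all of the following hold: (i) $A$ and $D$ are orthogonal matrices of $\pm1$; (ii) $B$ and $C$ are orthogonal Latin hypercubes; (iii) at least one of $A^TC=0$ and $B^TD=0$ is true; (iv) at least one of the following two conditions is true: (a) for any column index $i$, if row indices $p$ and $p'$ are such that $c_{pi}=-c_{p'i}$, then $a_{pi}=a_{p'i}$; (b) for any column index $j$, if row indices $q$ and $q'$ are such that $b_{qj}=-b_{q'j}$, then $d_{qj}=d_{q'j}$.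
   Context: A Latin hypercube of $n\ge 2$ runs with $m$ factors is an $n\times m$ matrix each of whose columns is a permutation of the $n$ levels $-(n-1)/2,-(n-3)/2,\ldots,(n-3)/2,(n-1)/2$. A matrix (or design) $X=(x_1,\ldots,x_m)$ with columns $x_i$ is called orthogonal if $x_i^Tx_j=0$ for all $i\ne j$ (it need not be square). An orthogonal Latin hypercube is a Latin hypercube that is orthogonal in this sense. $\otimes$ is the Kronecker product: $A\otimes B$ is the block matrix whose $(i,j)$ block is $a_{ij}B$. *)

(* Defs.v *)
From mathcomp Require Import all_boot all_order all_fingroup all_algebra.
From mathcomp Require Export mxtens.

Set Implicit Arguments.
Unset Strict Implicit.
Unset Printing Implicit Defensive.

Import Order.TTheory GRing.Theory Num.Theory.
Local Open Scope ring_scope.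

(* The Kronecker product is [tensmx] of mathcomp.real_closed.mxtens, written
   [A *t B]; its rows and columns are indexed by [mxtens_index (i, k)], of value
   [i * p + k] when [k : 'I_p], so that block (i, j) of [A *t B] is
   [A i j *: B].  All designs have entries in an arbitrary real field; the case
   of interest is the field of real numbers. *)

Section Designs.
Variable R : realFieldType.

Definition pm1_matrix n m (X : 'M[R]_(n, m)) : Prop :=
  forall i j, X i j = 1 \/ X i j = -1.

(* Distinct columns have zero inner product; [X] need not be square and no
   normalisation of the columns is required. *)
Definition orthogonal_columns n m (X : 'M[R]_(n, m)) : Prop :=
  forall i j, i != j -> (col i X)^T *m col j X = 0.

(* -(n-1)/2, -(n-3)/2, ..., (n-3)/2, (n-1)/2 *)
Definition levels n : 'cV[R]_n :=
  \col_(k < n) (- ((n%:R - 1) / 2) + k%:R).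

Definition latin_hypercube n m (X : 'M[R]_(n, m)) : Prop :=
  (2 <= n)%N /\
  forall j, exists s : 'S_n, col j X = row_perm s (levels n).

Definition orthogonal_latin_hypercube n m (X : 'M[R]_(n, m)) : Prop :=
  latin_hypercube X /\ orthogonal_columns X.

End Designs.

(* Main.v *)
(** Column (i, j) of L has entries n2 (d_q c_p) + a_p b_q, where d_q c_p and
    a_p b_q are again levels because the levels are symmetric about 0.  Writing
    levels as centred base-n2 digits, such a sum is a level for n1 n2 and
    determines both digits; condition (iv) then recovers p and q from them.
    For orthogonality, L^T L expands into four Kronecker products. *)
Require Import Defs.
From mathcomp Require Import all_boot all_order all_fingroup all_algebra.
From mathcomp Require Import mxtens ring lra.
Import GRing.Theory Num.Theory.
Local Open Scope ring_scope.

Section KroneckerDesigns.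
Set Implicit Arguments.
Unset Strict Implicit.
Context {R : realFieldType}.
Implicit Types n m : nat.

Lemma levels_inj n : injective (fun k => levels R n k 0).
Proof.
by move=> k l; rewrite !mxE => /addrI /eqP; rewrite eqr_nat => /eqP /val_inj.
Qed.

Lemma levels_rev n (k : 'I_n) : levels R n (rev_ord k) 0 = - levels R n k 0.
Proof. by rewrite !mxE /= natrB ?ltn_ord // -natr1; field. Qed.

(** The index [mxtens_index (u, v)] has value [u * m + v], and the centring constants fit: m(n-1)/2
    + (m-1)/2 = (nm-1)/2. *)
Lemma levels_mxtens n m (u : 'I_n) (v : 'I_m) :
  levels R (n * m) (mxtens_index (u, v)) 0 =
  m%:R * levels R n u 0 + levels R m v 0.
Proof. by rewrite !mxE /= natrD !natrM; field. Qed.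

(** For the converse, choose a level index for each row; the resulting self-map of ['I_n] is
    injective since the column is, hence a permutation by finiteness. *)
Lemma latin_columnP n m (X : 'M[R]_(n, m)) j :
  (exists s : 'S_n, col j X = row_perm s (levels R n)) <->
  (forall k, exists l, X k j = levels R n l 0) /\ injective (X ^~ j).
Proof.
split=> [[s /matrixP sX]|[levX injX]].
  have Xs k : X k j = levels R n (s k) 0.
    by have := sX k 0; rewrite mxE => ->; rewrite mxE.
  split=> [k|k l]; first by exists (s k).
  by rewrite !Xs => /levels_inj /perm_inj.
have /fin_all_exists[f fX] := levX.
have injf : injective f by move=> k l fkl; apply: injX; rewrite /= !fX fkl.
by exists (perm injf); apply/matrixP=> k i; rewrite ord1 [LHS]mxE fX [RHS]mxE permE.
Qed.

Lemma pm1_mul_level n (e x : R) : e = 1 \/ e = -1 ->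
  (exists l, x = levels R n l 0) -> exists l, e * x = levels R n l 0.
Proof.
move=> [] -> [l ->]; first by exists l; rewrite mul1r.
by exists (rev_ord l); rewrite levels_rev mulN1r.
Qed.

Lemma pm1_mul_eq (d d' x y : R) : d = 1 \/ d = -1 -> d' = 1 \/ d' = -1 ->
  d * x = d' * y -> x = y \/ x = - y.
Proof. by move=> [] -> [] -> ?; [left|right|right|left]; lra. Qed.

Lemma pm1_mulI (d x y : R) : d = 1 \/ d = -1 -> d * x = d * y -> x = y.
Proof. by move=> [] -> ?; lra. Qed.

(** The first equation forces [c p = c p'] or [c p = - c p']. Injectivity of [c] in one case and the
    sign hypothesis in the other give [a p = a p']. This sign cancels in the second equation, so
    [q = q']; then [d q] cancels in the first. The abstract index types let one lemma serve both
    alternatives of (iv). *)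
Lemma pm1_pair_inj (I J : Type) (a c : I -> R) (b d : J -> R) :
    (forall p, a p = 1 \/ a p = -1) -> (forall q, d q = 1 \/ d q = -1) ->
    injective c -> injective b ->
    (forall p p', c p = - c p' -> a p = a p') ->
  forall p p' q q', d q * c p = d q' * c p' -> a p * b q = a p' * b q' ->
  p = p' /\ q = q'.
Proof.
move=> a1 d1 injc injb ac p p' q q' dc ab.
have aE : a p = a p' by case: (pm1_mul_eq (d1 q) (d1 q') dc) => [/injc->|/ac].
have qE : q = q' by apply/injb/(pm1_mulI (a1 p)); rewrite ab aE.
by split=> //; apply/injc/(pm1_mulI (d1 q)); rewrite dc qE.
Qed.

Lemma orthogonal_columnsP n m (X : 'M[R]_(n, m)) :
  orthogonal_columns X <-> forall i j, i != j -> (X^T *m X) i j = 0.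
Proof.
have XE i j : ((col i X)^T *m col j X) 0 0 = (X^T *m X) i j.
  by rewrite !mxE; apply: eq_bigr => k _; rewrite !mxE.
split=> oX i j ij; first by rewrite -XE oX // mxE.
by apply/matrixP=> k l; rewrite !ord1 XE oX // mxE.
Qed.

(** Distinct pair indices differ in some component, and the Gram factor for that component
    vanishes. *)
Lemma tens_gram_orthogonal n m p q (X : 'M[R]_(n, m)) (Y : 'M[R]_(p, q)) i j :
  orthogonal_columns X -> orthogonal_columns Y -> i != j ->
  ((X^T *m X) *t (Y^T *m Y)) i j = 0.
Proof.
move=> /orthogonal_columnsP oX /orthogonal_columnsP oY.
case: (mxtens_indexP i) => i1 i2; case: (mxtens_indexP j) => j1 j2.
rewrite tensmxE; case: (eqVneq i1 j1) => [<-|/oX -> _]; last by rewrite mul0r.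
case: (eqVneq i2 j2) => [<-|/oY -> _]; last by rewrite mulr0.
by rewrite eqxx.
Qed.

(** The two mixed terms of the Gram matrix are multiples of the Kronecker product of [A^T *m C] and
    [B^T *m D] and of its transpose, so one zero factor kills both. The other two terms are products
    of Gram matrices. *)
Lemma orthogonal_columns_tensD n1 m1 n2 m2 (A C : 'M[R]_(n1, m1))
    (B D : 'M[R]_(n2, m2)) (gamma : R) :
    orthogonal_columns A -> orthogonal_columns B ->
    orthogonal_columns C -> orthogonal_columns D ->
    A^T *m C = 0 \/ B^T *m D = 0 ->
  orthogonal_columns (A *t B + gamma *: (C *t D)).
Proof.
move=> oA oB oC oD ACBD.
have cross : (A^T *m C) *t (B^T *m D) = 0.
  by case: ACBD => ->; rewrite ?tens0mx ?tensmx0.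
have cross' : (C^T *m A) *t (D^T *m B) = 0.
  by rewrite -[LHS]trmxK trmx_tens !trmx_mul !trmxK cross trmx0.
apply/orthogonal_columnsP=> i j ij.
rewrite [(_ + _)^T]raddfD [X in _ + X]linearZ /= !trmx_tens.
rewrite mulmxDl !mulmxDr -!scalemxAl -!scalemxAr.
rewrite !tensmx_mul cross cross' !scaler0 addr0 add0r.
have gram0 := tens_gram_orthogonal _ _ ij.
by rewrite mxE gram0 // add0r 2!mxE gram0 // !mulr0.
Qed.

End KroneckerDesigns.

Theorem theorem1 (R : realFieldType) (n1 m1 n2 m2 : nat)
    (A : 'M[R]_(n1, m1)) (B : 'M[R]_(n2, m2))
    (C : 'M[R]_(n1, m1)) (D : 'M[R]_(n2, m2))
    (gamma : R) (hgamma : gamma = n2%:R)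
    (hA : pm1_matrix A /\ orthogonal_columns A)
    (hD : pm1_matrix D /\ orthogonal_columns D)
    (hB : orthogonal_latin_hypercube B)
    (hC : orthogonal_latin_hypercube C)
    (hiii : A^T *m C = 0 \/ B^T *m D = 0)
    (hiv : (forall (i : 'I_m1) (p p' : 'I_n1),
              C p i = - C p' i -> A p i = A p' i) \/
           (forall (j : 'I_m2) (q q' : 'I_n2),
              B q j = - B q' j -> D q j = D q' j)) :
  orthogonal_latin_hypercube (A *t B + gamma *: (C *t D)).
Proof.
case: hA hD hB hC => A1 oA [D1 oD] [[n2_ge2 latB] oB] [[n1_ge2 latC] oC].
split; last exact: orthogonal_columns_tensD.
split=> [|ij]; first exact: leq_trans n1_ge2 (leq_pmulr _ (ltnW n2_ge2)).
case: (mxtens_indexP ij) => i j.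
have [levC injC] := (latin_columnP C i).1 (latC i).
have [levB injB] := (latin_columnP B j).1 (latB j).
have LE p q : (A *t B + gamma *: (C *t D)) (mxtens_index (p, q))
    (mxtens_index (i, j)) = n2%:R * (D q j * C p i) + A p i * B q j.
  by rewrite mxE [X in _ + X]mxE !tensmxE hgamma; ring.
have levDC p q := pm1_mul_level (D1 q j) (levC p).
have levAB p q := pm1_mul_level (A1 p i) (levB q).
apply/latin_columnP; split=> [k|k k' /=].
  case: (mxtens_indexP k) => p q; have [u uE] := levDC p q.
  have [v vE] := levAB p q.
  by exists (mxtens_index (u, v)); rewrite LE levels_mxtens uE vE.
case: (mxtens_indexP k) => p q; case: (mxtens_indexP k') => p' q'.
rewrite !LE => eqL.
(* Uniqueness of the two digits: equal levels for [n1 * n2] have equal indices, and [mxtens_index]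
   is injective. *)
have [DC AB] : D q j * C p i = D q' j * C p' i /\ A p i * B q j = A p' i * B q' j.
  move: eqL; have [u ->] := levDC p q; have [v ->] := levAB p q.
  have [u' ->] := levDC p' q'; have [v' ->] := levAB p' q'.
  by rewrite -!levels_mxtens => /levels_inj /(can_inj (@mxtens_indexK _ _)) [-> ->].
case: hiv => [/(_ i)|/(_ j)] iv.
  by have [-> ->] := pm1_pair_inj (A1^~ i) (D1^~ j) injC injB iv DC AB.
(* Under (b) the roles are exchanged: [D], [B] replace [A], [C], and [q] is recovered after [p]'s
   sign ambiguity is removed through [D]. *)
by have [-> ->] := pm1_pair_inj (D1^~ j) (A1^~ i) injB injC iv AB DC.
Qed.
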